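(* Let $\mathcal C=\mathcal D\cup\mathcal T\cup\mathcal A\cup\mathcal L$. Let $G$ be a group with property $R_\infty$ and let $H$ be a group in $\mathcal C$. Suppose that every homomorphism $H\to G$ is trivial. Then: (i) $G\times H$ has property $R_\infty$; (ii) if $G$ is freely indecomposable or is a finite free product, then $G*H$ has property $R_\infty$.
   Context: **Property $R_\infty$.** For an endomorphism $\varphi:\pi\to\pi$ of a group, $R(\varphi)$ is the number of orbits of the action of $\pi$ on itself given by $\sigma\cdot\alpha=\sigma\alpha\varphi(\sigma)^{-1}$. A group $\pi$ has property $R_\infty$ if $R(\varphi)=\infty$ for every $\varphi\in\mathrm{Aut}(\pi)$. **Classes of groups.** $\mathcal D$: divisible groups, i.e. groups in which for each element $g$ and each integer $n>1$ there is $h$ with $g=h^n$ (not necessarily abelian). $\mathcal T$: torsion groups. $\mathcal A$: finitely generated acyclic groups, i.e. those whose reduced homology with trivial $\mathbb Z$ coefficients vanishes. $\mathcal L$: all finite index subgroups of direct products $\prod_{1\le i\le n}L_i$, where each $L_i$ is an irreducible lattice in a connected semisimple real linear Lie group $G_i$ without compact factors and of real rank at least $2$. $G*H$ denotes the free product; a group is freely indecomposable if it is not a free product of two non-trivial groups. *)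

(* Defs.v *)
From HB Require Import structures.
From mathcomp Require Import all_boot all_order all_algebra.
From mathcomp Require Import all_classical all_reals all_analysis.
From mathcomp Require Import freeg.

Set Implicit Arguments.
Unset Strict Implicit.
Unset Printing Implicit Defensive.

Import Order.TTheory GRing.Theory Num.Theory.
Import numFieldNormedType.Exports.

Local Open Scope classical_set_scope.
Local Open Scope group_scope.

Definition twisted_class (G : groupType) (phi : G -> G) (x : G) : set G :=
  [set s * x * (phi s)^-1 | s in [set: G]].

Definition Reidemeister_classes (G : groupType) (phi : G -> G) : set (set G) :=
  range (twisted_class phi).

Definition R_infinity (G : groupType) : Prop :=
  forall phi : {multiplicative G -> G}, bijective phi ->
    infinite_set (Reidemeister_classes phi).

Definition is_subgroup (G : groupType) (A : set G) : Prop :=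
  [/\ A 1, (forall x y, A x -> A y -> A (x * y)) & (forall x, A x -> A x^-1)].

Definition generated (G : groupType) (S : set G) : set G :=
  smallest (@is_subgroup G) S.

Definition is_normal_in (G : groupType) (N A : set G) : Prop :=
  [/\ is_subgroup N, N `<=` A & forall a x, A a -> N x -> N (x ^ a)].

Definition set_prod (G : groupType) (A B : set G) : set G :=
  [set a * b | a in A & b in B].

Definition left_coset (G : groupType) (x : G) (A : set G) : set G :=
  [set x * a | a in A].

Definition left_cosets (G : groupType) (A B : set G) : set (set G) :=
  [set left_coset x B | x in A].

Definition finite_index (G : groupType) (B A : set G) : Prop :=
  [/\ is_subgroup B, B `<=` A & finite_set (left_cosets A B)].

Definition derived_subgroup (G : groupType) (A : set G) : set G :=
  generated [set [~ x, y] | x in A & y in A].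

Definition solvable_subgroup (G : groupType) (A : set G) : Prop :=
  exists k : nat, iter k (@derived_subgroup G) A = [set 1].

(* P is G * H, characterised by its universal property. *)
Definition is_free_product (G H P : groupType)
    (i : {multiplicative G -> P}) (j : {multiplicative H -> P}) : Prop :=
  forall (Q : groupType)
    (f : {multiplicative G -> Q}) (g : {multiplicative H -> Q}),
    (exists h : {multiplicative P -> Q},
       (forall x, h (i x) = f x) /\ (forall y, h (j y) = g y)) /\
    (forall h h' : {multiplicative P -> Q},
       (forall x, h (i x) = h' (i x)) -> (forall y, h (j y) = h' (j y)) ->
       h =1 h').

Definition is_family_free_product (I : Type) (K : I -> groupType)
    (P : groupType) (i : forall k, {multiplicative K k -> P}) : Prop :=
  forall (Q : groupType) (f : forall k, {multiplicative K k -> Q}),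
    (exists h : {multiplicative P -> Q}, forall k x, h (i k x) = f k x) /\
    (forall h h' : {multiplicative P -> Q},
       (forall k x, h (i k x) = h' (i k x)) -> h =1 h').

Definition nontrivial (G : groupType) : Prop := exists x : G, x != 1.

Definition freely_indecomposable (G : groupType) : Prop :=
  ~ exists (A B : groupType)
      (i : {multiplicative A -> G}) (j : {multiplicative B -> G}),
      [/\ nontrivial A, nontrivial B & is_free_product i j].

(* At least two factors, all nontrivial: otherwise every group would qualify
   as the free product of itself. *)
Definition finite_free_product (G : groupType) : Prop :=
  exists (n : nat) (K : 'I_n -> groupType)
    (i : forall k, {multiplicative K k -> G}),
    [/\ (1 < n)%N, (forall k, nontrivial (K k)) & is_family_free_product i].

Definition divisible_group (H : groupType) : Prop :=
  forall (g : H) (n : nat), (1 < n)%N -> exists h : H, g = h ^+ n.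

Definition torsion_group (H : groupType) : Prop :=
  forall g : H, exists2 n : nat, (0 < n)%N & g ^+ n = 1.

Definition finitely_generated (H : groupType) : Prop :=
  exists s : seq H, generated [set` s] = [set: H].

(* Homology with trivial integer coefficients is computed by the inhomogeneous
   bar complex: the degree n chains are the free abelian group on n-tuples
   [g_0 | ... | g_(n-1)], and the i-th face of an (n+1)-tuple drops g_0 if
   i = 0, multiplies g_(i-1) and g_i if 0 < i <= n, and drops g_n if
   i = n + 1. *)
Definition bar_chain (H : groupType) (n : nat) := {freeg {ffun 'I_n -> H}}.

Definition bar_face (H : groupType) (n : nat) (i : nat)
    (g : {ffun 'I_n.+1 -> H}) : {ffun 'I_n -> H} :=
  [ffun j : 'I_n =>
     let gj := g (widen_ord (leqnSn n) j) in
     let gj1 := g (fintype.lift ord0 j) in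
     if (j.+1 < i)%N then gj else if j.+1 == i then gj * gj1 else gj1].

Definition bar_boundary (H : groupType) (n : nat)
    (c : bar_chain H n.+1) : bar_chain H n :=
  fglift (fun g => \sum_(i < n.+2) (-1 : int) ^+ i *: << bar_face i g >>)%R c.

(* The reduced homology in degree 0 vanishes for every group, so only positive
   degrees are constrained. *)
Definition acyclic_group (H : groupType) : Prop :=
  forall (n : nat) (c : bar_chain H n.+1), bar_boundary c = 0%R ->
    exists d : bar_chain H n.+2, bar_boundary d = c.

Record GLmx (R : realType) (n : nat) : Type := MkGLmx {
  gl_val : 'M[R]_n;
  gl_valP : gl_val \in unitmx
}.

Section GLmxGroup.
Context (R : realType) (n : nat).
Implicit Types a b : GLmx R n.

HB.instance Definition _ := [isSub for @gl_val R n].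
HB.instance Definition _ := [Choice of GLmx R n by <:].

Definition gl_one : GLmx R n := MkGLmx (unitmx1 R n).

Fact gl_mul_subproof a b : (gl_val a *m gl_val b)%R \in unitmx.
Proof. by rewrite unitmx_mul (gl_valP a) (gl_valP b). Qed.

Definition gl_mul a b : GLmx R n := MkGLmx (gl_mul_subproof a b).

Fact gl_inv_subproof a : invmx (gl_val a) \in unitmx.
Proof. by rewrite unitmx_inv (gl_valP a). Qed.

Definition gl_inv a : GLmx R n := MkGLmx (gl_inv_subproof a).

Fact gl_mulA : associative gl_mul.
Proof. by move=> a b c; apply: val_inj; exact: mulmxA. Qed.

Fact gl_mul1 : left_id gl_one gl_mul.
Proof. by move=> a; apply: val_inj; exact: mul1mx. Qed.

Fact gl_mulr1 : right_id gl_one gl_mul.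
Proof. by move=> a; apply: val_inj; exact: mulmx1. Qed.

Fact gl_mulV : left_inverse gl_one gl_inv gl_mul.
Proof. by move=> a; apply: val_inj; exact: (mulVmx (gl_valP a)). Qed.

Fact gl_mulrV : right_inverse gl_one gl_inv gl_mul.
Proof. by move=> a; apply: val_inj; exact: (mulmxV (gl_valP a)). Qed.

HB.instance Definition _ := isGroup.Build (GLmx R n)
  gl_mulA gl_mul1 gl_mulr1 gl_mulV gl_mulrV.

HB.instance Definition _ :=
  Topological.copy (GLmx R n) (initial_topology (@gl_val R n)).

End GLmxGroup.

(* A connected semisimple real linear Lie group is, up to isomorphism, a closed
   connected semisimple subgroup of some GL_n(R). *)
Section LinearLieGroups.
Context (R : realType) (n : nat).
Implicit Types G N A : set (GLmx R n).

Definition closed_connected_subgroup G : Prop :=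
  [/\ is_subgroup G, closed G & connected G].

(* The radical is the largest connected closed solvable normal subgroup. *)
Definition semisimple G : Prop :=
  forall N, is_normal_in N G -> closed_connected_subgroup N ->
    solvable_subgroup N -> N = [set 1].

Definition no_compact_factors G : Prop :=
  forall N, is_normal_in N G -> connected N -> compact N -> N = [set 1].

Definition expmx (X : 'M[R]_n) : 'M[R]_n :=
  lim (series (fun k : nat => (k`!%:R)^-1 *: X ^+ k)%R @ \oo).

Definition lie_algebra G : set 'M[R]_n :=
  [set X | forall t : R, exists2 g, G g & gl_val g = expmx (t *: X)%R].

Definition lie_dim_ge (k : nat) G : Prop :=
  exists2 s : k.-tuple 'M[R]_n, [set` s] `<=` lie_algebra G & free s.

Definition split_torus A : Prop :=
  closed_connected_subgroup A /\
  exists2 P : 'M[R]_n, P \in unitmx &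
    forall a, A a -> is_diag_mx (P *m gl_val a *m invmx P)%R.

(* The real rank is the largest dimension of an R-split torus. *)
Definition real_rank_ge (k : nat) G : Prop :=
  exists A, [/\ A `<=` G, split_torus A & lie_dim_ge k A].

End LinearLieGroups.

Section Lattices.
Context (R : realType) (n : nat).
Implicit Types G L N : set (GLmx R n).

Definition discrete_subset L : Prop := L `<=` isolated L.

(* Open sets of the quotient topology on G / L. *)
Definition coset_open G L : set (set (set (GLmx R n))) :=
  [set V | V `<=` left_cosets G L /\
     exists2 U : set (GLmx R n), open U &
       \bigcup_(C in V) C = U `&` G].

(* There is a nonzero finite G-invariant Borel measure on G / L. The
   sigma-algebra lives on all sets of matrices, but only its trace on G / L
   matters. *)
Definition finite_covolume G L : Prop :=
  exists mu : {measure set (g_sigma_algebraType (coset_open G L)) -> \bar R}%R,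
    [/\ (0 < mu (left_cosets G L))%E, (mu (left_cosets G L) < +oo)%E &
        forall (g : GLmx R n) (V : set (set (GLmx R n))), G g ->
          V `<=` left_cosets G L -> (coset_open G L).-sigma.-measurable V ->
          mu [set left_coset g C | C in V] = mu V].

Definition is_lattice G L : Prop :=
  [/\ is_subgroup L, L `<=` G, discrete_subset L & finite_covolume G L].

(* L is reducible if G = N1 N2 with N1, N2 infinite connected normal subgroups
   with discrete intersection, and (L n N1)(L n N2) has finite index in L. *)
Definition reducible_lattice G L : Prop :=
  exists N1 N2,
    [/\ is_normal_in N1 G /\ is_normal_in N2 G,
        closed_connected_subgroup N1 /\ closed_connected_subgroup N2,
        infinite_set N1 /\ infinite_set N2,
        set_prod N1 N2 = G /\ discrete_subset (N1 `&` N2) &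
        finite_index (set_prod (L `&` N1) (L `&` N2)) L].

Definition irreducible_lattice G L : Prop :=
  is_lattice G L /\ ~ reducible_lattice G L.

Definition higher_rank_irreducible_lattice L : Prop :=
  exists G,
    [/\ closed_connected_subgroup G, semisimple G, no_compact_factors G,
        real_rank_ge 2 G & irreducible_lattice G L].

End Lattices.

Definition dprod (I : Type) (K : I -> groupType) : Type := forall i, K i.

Section DirectProduct.
Context (I : Type) (K : I -> groupType).
Implicit Types x y : dprod K.

HB.instance Definition _ := gen_eqMixin (dprod K).
HB.instance Definition _ := gen_choiceMixin (dprod K).

Definition dprod_one : dprod K := fun=> 1.
Definition dprod_mul x y : dprod K := fun i => x i * y i.
Definition dprod_inv x : dprod K := fun i => (x i)^-1.

Fact dprod_mulA : associative dprod_mul.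
Proof. by move=> x y z; apply: functional_extensionality_dep => i; exact: mulgA. Qed.

Fact dprod_mul1 : left_id dprod_one dprod_mul.
Proof. by move=> x; apply: functional_extensionality_dep => i; exact: mul1g. Qed.

Fact dprod_mulr1 : right_id dprod_one dprod_mul.
Proof. by move=> x; apply: functional_extensionality_dep => i; exact: mulg1. Qed.

Fact dprod_mulV : left_inverse dprod_one dprod_inv dprod_mul.
Proof. by move=> x; apply: functional_extensionality_dep => i; exact: mulVg. Qed.

Fact dprod_mulrV : right_inverse dprod_one dprod_inv dprod_mul.
Proof. by move=> x; apply: functional_extensionality_dep => i; exact: mulgV. Qed.

HB.instance Definition _ := isGroup.Build (dprod K)
  dprod_mulA dprod_mul1 dprod_mulr1 dprod_mulV dprod_mulrV.

End DirectProduct.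

Definition class_D (H : groupType) : Prop := divisible_group H.

Definition class_T (H : groupType) : Prop := torsion_group H.

Definition class_A (H : groupType) : Prop :=
  finitely_generated H /\ acyclic_group H.

Definition class_L (R : realType) (H : groupType) : Prop :=
  exists (n : nat) (d : 'I_n -> nat)
    (L : forall i, set (GLmx R (d i)))
    (f : {multiplicative H -> dprod (fun i => GLmx R (d i))}),
    [/\ (0 < n)%N,
        forall i, higher_rank_irreducible_lattice (L i),
        injective f &
        finite_index (range f) [set x | forall i, L i (x i)]].

Definition class_C (R : realType) (H : groupType) : Prop :=
  [\/ class_D H, class_T H, class_A H | class_L R H].

(* Main.v *)
(* Since every homomorphism from H to G is trivial, every homomorphism from
   G x H or G * H to G factors through the retraction p onto G that kills H.
   Applied to the composites of p with an automorphism phi and with its inverse,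
   this makes phi descend to an automorphism f of G; then p maps the twisted
   classes of phi onto those of f, of which there are infinitely many. *)
Require Import Defs.
From HB Require Import structures.
From mathcomp Require Import all_boot all_order all_algebra.
From mathcomp Require Import all_classical all_reals all_analysis.

Local Open Scope classical_set_scope.
Local Open Scope group_scope.

Lemma multiplicative1 {G H : groupType} (f : {multiplicative G -> H}) : f 1 = 1.
Proof. by apply: (mulgI (f 1)); rewrite -gmulfM !mulg1. Qed.

Lemma multiplicativeV {G H : groupType} (f : {multiplicative G -> H}) (x : G) :
  f x^-1 = (f x)^-1.
Proof. by apply: (mulgI (f x)); rewrite -gmulfM !mulgV multiplicative1. Qed.

(** The factoring argument composes [p] with the inverse of an automorphism too, and that composite
    must be a bundled homomorphism. *)
Lemma inverse_multiplicative (G H : groupType) (f : {multiplicative G -> H}) :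
  bijective f ->
  exists2 g : {multiplicative H -> G}, cancel f g & cancel g f.
Proof.
case=> g fK gK.
pose gM := isMultiplicative.Build H G g (can2_gmulfM fK gK).
pose g' : {multiplicative H -> G} := HB.pack g gM.
by exists g'.
Qed.

(** Applying [p] to [s * x * (phi s)^-1] gives [p s * p x * (f (p s))^-1], and by surjectivity [p s]
    runs through all of [G]. *)
Lemma image_twisted_class {P G : groupType} (p : {multiplicative P -> G})
    (phi : P -> P) (f : G -> G) (x : P) :
  (forall y, exists z, p z = y) -> (forall z, p (phi z) = f (p z)) ->
  p @` twisted_class phi x = twisted_class f (p x).
Proof.
move=> p_surj pf; apply/seteqP; split=> [_ [_ [s _ <-] <-]|_ [t _ <-]].
  by exists (p s) => //; rewrite !gmulfM multiplicativeV pf.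
have [s <-] := p_surj t.
by exists (s * x * (phi s)^-1); [exists s | rewrite !gmulfM multiplicativeV pf].
Qed.

Lemma infinite_Reidemeister_classes_surj {P G : groupType}
    {p : {multiplicative P -> G}} {phi : P -> P} {f : G -> G} :
  (forall y, exists z, p z = y) -> (forall z, p (phi z) = f (p z)) ->
  infinite_set (Reidemeister_classes f) ->
  infinite_set (Reidemeister_classes phi).
Proof.
move=> p_surj pf Gf_inf Pphi_fin; apply: Gf_inf.
apply: sub_finite_set (finite_image (fun C => p @` C) Pphi_fin) => _ [y _ <-].
have [x <-] := p_surj y.
exists (twisted_class phi x); first by exists x.
exact: image_twisted_class.
Qed.

Lemma R_infinity_of_factoring {P G : groupType} {p : {multiplicative P -> G}} :
  (forall y, exists z, p z = y) ->
  (forall q : {multiplicative P -> G},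
     exists f : {multiplicative G -> G}, forall z, q z = f (p z)) ->
  R_infinity G -> R_infinity P.
Proof.
move=> p_surj factor G_inf phi /inverse_multiplicative[psi phiK psiK].
have [f pf] := factor (p \o phi).
have [g pg] := factor (p \o psi).
apply: (infinite_Reidemeister_classes_surj p_surj pf).
(* Since [phi] and [psi] are mutually inverse, so are [f] and [g] on values of [p], that is, on all
   of [G]. *)
apply: G_inf; exists g => y; have [z <-] := p_surj y.
  by rewrite -pf -pg /= phiK.
by rewrite -pg -pf /= psiK.
Qed.

Lemma R_infinity_of_retraction {G H P : groupType}
    {i : {multiplicative G -> P}} {j : {multiplicative H -> P}}
    {p : {multiplicative P -> G}} :
  cancel i p -> (forall y, p (j y) = 1) ->
  (forall q q' : {multiplicative P -> G},
     (forall x, q (i x) = q' (i x)) -> (forall y, q (j y) = q' (j y)) ->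
     q =1 q') ->
  (forall (f : {multiplicative H -> G}) (y : H), f y = 1) ->
  R_infinity G -> R_infinity P.
Proof.
move=> iK pj1 joint_epi Hom1; apply: R_infinity_of_factoring => [x|q].
  by exists (i x); exact: iK.
(* The factor is the restriction of [q] to [G]: [q] and [q \o i \o p] agree on [i x] because [p]
   retracts [i], and both are trivial on [j y]. *)
exists (q \o i); apply: (joint_epi q (q \o i \o p)) => [x|y] /=.
  by rewrite iK.
by rewrite pj1 !multiplicative1; exact: (Hom1 (q \o j)).
Qed.

Lemma R_infinity_prod {G H : groupType} :
  (forall (f : {multiplicative H -> G}) (y : H), f y = 1) ->
  R_infinity G -> R_infinity (G * H)%type.
Proof.
have iM : {morph (fun x : G => (x, 1 : H)) : x y / x * y}.
  by move=> x y; congr pair; rewrite mulg1.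
have jM : {morph (fun y : H => (1 : G, y)) : x y / x * y}.
  by move=> x y; congr pair; rewrite mulg1.
pose i : {multiplicative G -> (G * H)%type} :=
  HB.pack (fun x : G => (x, 1 : H)) (isMultiplicative.Build _ _ _ iM).
pose j : {multiplicative H -> (G * H)%type} :=
  HB.pack (fun y : H => (1 : G, y)) (isMultiplicative.Build _ _ _ jM).
apply: (@R_infinity_of_retraction G H _ i j fst) => // q q' qi qj [x y].
(* The two factors generate the product, so a homomorphism is determined by its restrictions to
   them. *)
have -> : (x, y) = i x * j y by congr pair; rewrite ?mulg1 ?mul1g.
by rewrite !gmulfM qi qj.
Qed.

Lemma R_infinity_free_product {G H P : groupType}
    {i : {multiplicative G -> P}} {j : {multiplicative H -> P}} :
  is_free_product i j ->
  (forall (f : {multiplicative H -> G}) (y : H), f y = 1) ->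
  R_infinity G -> R_infinity P.
Proof.
move=> ij_free.
(* The retraction [p] is induced by the identity of [G] and the trivial map on [H]; [joint_epi] is
   the uniqueness half of the universal property. *)
have [[p [iK pj1]] joint_epi] := ij_free G idfun (@one_fun H G).
exact: (R_infinity_of_retraction iK pj1 joint_epi).
Qed.

Theorem proposition5p2 (R : realType) (G H : groupType)
  (R_infinity_G : R_infinity G)
  (class_C_H : class_C R H)
  (Hom_H_G_trivial : forall (f : {multiplicative H -> G}) (x : H), f x = 1%g) :
  R_infinity (G * H)%type /\
  (freely_indecomposable G \/ finite_free_product G ->
   forall (P : groupType) (i : {multiplicative G -> P})
     (j : {multiplicative H -> P}),
     is_free_product i j -> R_infinity P).
Proof.
split; first exact: R_infinity_prod.
by move=> _ P i j ij_free; exact: (R_infinity_free_product ij_free).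
Qed.
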